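(* Let $t_1,\dots,t_m\in\mathbb{R}$ be distinct, $D=\operatorname{diag}(t_1,\dots,t_m)$, and let $\mathbf C=\begin{bmatrix}D&O\\ I&D\end{bmatrix}\in\mathbb{R}^{2m\times 2m}$ be the augmented confluent operator. Let $1\le k\le 2m-1$. The Arnoldi orthogonalization process applied for $k$ steps to $\mathbf C$ with starting vector $\mathbf b=[\mathbf e_m^T,\mathbf 0_m^T]^T$ generates an augmented basis matrix $\mathcal Q=\begin{bmatrix}Q_f\\ Q_d\end{bmatrix}\in\mathbb{R}^{2m\times(k+1)}$ for Hermite interpolation. When the process is carried out in floating-point arithmetic with machine epsilon $\varepsilon_{\mathrm{mach}}$ and with appropriate reorthogonalization, the condition number of this matrix satisfies $$\kappa_2(\mathcal Q)=1+\mathcal O(\varepsilon_{\mathrm{mach}}).$$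
   Context: $\mathbf e_m=(1,\dots,1)^T\in\mathbb{R}^m$, $\mathbf 0_m$ is the zero vector in $\mathbb{R}^m$, and $I,O$ are the $m\times m$ identity and zero matrices. Arnoldi process on $(\mathbf C,\mathbf b)$: start from $q_1=\mathbf b/\|\mathbf b\|_2$; for $j=1,\dots,k$ orthogonalize $\mathbf C q_j$ against $q_1,\dots,q_j$ by the Gram–Schmidt process with coefficients $H_{ij}$ ($i\le j$), let $H_{j+1,j}$ be the norm of the remainder and $q_{j+1}$ the normalized remainder. In exact arithmetic $\mathcal Q=[q_1,\dots,q_{k+1}]$ has orthonormal columns, spans the Krylov space $\operatorname{span}\{\mathbf b,\mathbf C\mathbf b,\dots,\mathbf C^k\mathbf b\}$, and $\mathbf C[q_1,\dots,q_k]=\mathcal Q\mathcal H$ with $\mathcal H\in\mathbb{R}^{(k+1)\times k}$ upper Hessenberg. $Q_f,Q_d\in\mathbb{R}^{m\times(k+1)}$ are the upper and lower halves of $\mathcal Q$. ''With appropriate reorthogonalization'' means that orthogonalization is performed by modified Gram–Schmidt with a second orthogonalization pass at each step, or by a Householder-based Arnoldi implementation. Floating-point arithmetic follows the standard model $\mathrm{fl}(x\,\mathrm{op}\,y)=(x\,\mathrm{op}\,y)(1+\delta)$, $|\delta|\le\varepsilon_{\mathrm{mach}}$. $\kappa_2$ is the ratio of the largest to the smallest singular value. The $\mathcal O$ is as $\varepsilon_{\mathrm{mach}}\to0$ for given nodes and $k$. *)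

(* Defs.v *)
From HB Require Import structures.
From mathcomp Require Import all_boot all_order all_algebra.
From mathcomp Require Import all_classical all_reals all_analysis.

Set Implicit Arguments.
Unset Strict Implicit.
Unset Printing Implicit Defensive.

Import Order.TTheory GRing.Theory Num.Theory.
Import numFieldNormedType.Exports.

Local Open Scope classical_set_scope.
Local Open Scope ring_scope.

Section Vectors.
Variables (R : realType) (n : nat).
Implicit Types (u v : 'cV[R]_n).

Definition dotv u v : R := \sum_i u i 0 * v i 0.

Definition norm2 v : R := Num.sqrt (dotv v v).

Definition normalize v : 'cV[R]_n := (norm2 v)^-1 *: v.

(* The matrix with columns s_0, ..., s_(p-1). *)
Definition mx_of_cols p (s : seq 'cV[R]_n) : 'M[R]_(n, p) :=
  \matrix_(i, j) s`_j i 0.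

End Vectors.

Section ConditionNumber.
Variables (R : realType) (n p : nat).
Implicit Types (A : 'M[R]_(n, p)).

(* For p <= n, the only case used, the eigenvalues of the p x p Gram matrix are
   the squares of all p singular values of A. *)
Definition singular_values A : set R :=
  [set s | 0 <= s /\ eigenvalue (A^T *m A) (s ^+ 2)].

(* A finite set, nonempty if 0 < p <= n: sup and inf are then attained. *)
Definition sigma_max A : R := sup (singular_values A).
Definition sigma_min A : R := inf (singular_values A).

(* Meaningful only if 0 < sigma_min A, since x / 0 = 0. *)
Definition kappa2 A : R := sigma_max A / sigma_min A.

End ConditionNumber.

Section ConfluentOperator.
Variables (R : realType) (m : nat).

Definition confluent_operator (t : 'I_m -> R) : 'M[R]_(m + m) :=
  let D := diag_mx (\row_i t i) in block_mx D 0 1%:M D.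

Definition start_vector : 'cV[R]_(m + m) := col_mx (const_mx 1) 0.

(* The columns of Q hold the values (upper half) and the derivatives (lower
   half) at the nodes of the members of a basis of the polynomials of degree
   at most k. *)
Definition hermite_basis_matrix k (t : 'I_m -> R)
    (Q : 'M[R]_(m + m, k.+1)) : Prop :=
  exists2 p : k.+1.-tuple {poly_k.+1 R}, basis_of fullv p &
    forall (i : 'I_m) (j : 'I_k.+1),
      usubmx Q i j = (tnth p j : {poly R}).[t i] /\
      dsubmx Q i j = (tnth p j : {poly R})^`().[t i].

End ConfluentOperator.

Section ExactArnoldi.
Variables (R : realType) (n : nat) (C : 'M[R]_n) (b : 'cV[R]_n).

(* For s = [:: q_1; ...; q_j]: the remainder C q_j - \sum_(i <= j) H_ij q_i with
   H_ij = <q_i, C q_j>; its norm is H_(j+1,j). *)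
Definition arnoldi_remainder (s : seq 'cV[R]_n) : 'cV[R]_n :=
  let w := C *m last 0 s in w - \sum_(q <- s) dotv q w *: q.

(* The vectors q_1, ..., q_(j+1) obtained after j steps. *)
Fixpoint arnoldi j : seq 'cV[R]_n :=
  if j is j'.+1 then
    let s := arnoldi j' in rcons s (normalize (arnoldi_remainder s))
  else [:: normalize b].

Definition arnoldi_no_breakdown k : Prop :=
  forall j, (j < k)%N -> arnoldi_remainder (arnoldi j) != 0.

Definition arnoldi_matrix k : 'M[R]_(n, k.+1) := mx_of_cols k.+1 (arnoldi k).

End ExactArnoldi.

(* sum_tree add s x: x results from adding up the terms of s with add, in some
   order and with some bracketing. The two operands of an addition are sums of
   nonempty lists, so exactly size s - 1 additions are performed. *)
Inductive sum_tree (R : realType) (add : R -> R -> R) : seq R -> R -> Prop :=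
| SumNil : sum_tree add [::] 0
| SumOne x : sum_tree add [:: x] x
| SumAdd s s1 s2 x1 x2 of
    perm_eq s (s1 ++ s2) & s1 != [::] & s2 != [::] &
    sum_tree add s1 x1 & sum_tree add s2 x2 :
    sum_tree add s (add x1 x2).

(* A floating-point arithmetic obeying the standard model (no overflow or
   underflow) with machine epsilon eps. The operations are total on R: an
   arithmetic given only on a set of floating-point numbers is covered by
   extending it with exact results elsewhere. Division by 0 and square roots of
   negative numbers are left unspecified, and so is the order of summation. *)
Record fp_arith (R : realType) (eps : R) := FpArith {
  fl_add : R -> R -> R;
  fl_sub : R -> R -> R;
  fl_mul : R -> R -> R;
  fl_div : R -> R -> R;
  fl_sqrt : R -> R;
  fl_sum : seq R -> R;
  fl_addP : forall x y,
    exists2 d, `|d| <= eps & fl_add x y = (x + y) * (1 + d);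
  fl_subP : forall x y,
    exists2 d, `|d| <= eps & fl_sub x y = (x - y) * (1 + d);
  fl_mulP : forall x y,
    exists2 d, `|d| <= eps & fl_mul x y = (x * y) * (1 + d);
  fl_divP : forall x y, y != 0 ->
    exists2 d, `|d| <= eps & fl_div x y = (x / y) * (1 + d);
  fl_sqrtP : forall x, 0 <= x ->
    exists2 d, `|d| <= eps & fl_sqrt x = Num.sqrt x * (1 + d);
  fl_sumP : forall s, sum_tree fl_add s (fl_sum s)
}.

Section FloatingPointKernels.
Variables (R : realType) (eps : R) (F : fp_arith eps) (n : nat).
Implicit Types (u v w x q z : 'cV[R]_n).

Definition fl_dotv u v : R :=
  fl_sum F [seq fl_mul F (u i 0) (v i 0) | i <- enum 'I_n].

Definition fl_norm2 v : R := fl_sqrt F (fl_dotv v v).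

Definition fl_normalize v : 'cV[R]_n :=
  \col_i fl_div F (v i 0) (fl_norm2 v).

Definition fl_mulmx (C : 'M[R]_n) x : 'cV[R]_n :=
  \col_i fl_sum F [seq fl_mul F (C i j) (x j 0) | j <- enum 'I_n].

(* w - a v *)
Definition fl_submul w (a : R) v : 'cV[R]_n :=
  \col_i fl_sub F (w i 0) (fl_mul F a (v i 0)).

(* One modified Gram-Schmidt pass: each coefficient is computed from the
   current, already partially orthogonalized, vector. *)
Definition fl_mgs_pass (s : seq 'cV[R]_n) w : 'cV[R]_n :=
  foldl (fun w q => fl_submul w (fl_dotv q w) q) w s.

(* Householder vector annihilating the entries of z below the j-th (indices
   start at 0): with x the trailing part z_j, ..., z_(n-1), it is
   x + sign(x_0) ||x|| e_0 padded by j zeros, with sign(0) = 1. *)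
Definition fl_house (j : nat) z : 'cV[R]_n :=
  let x := \col_i (if (i < j)%N then 0 else z i 0) in
  \col_i if i == j :> nat then
           if 0 <= z i 0 then fl_add F (z i 0) (fl_norm2 x)
           else fl_sub F (z i 0) (fl_norm2 x)
         else x i 0.

(* Application of I - beta v v^T, beta = 2 / (v^T v), without forming the
   matrix. The vector v = 0 (nothing to annihilate) encodes the identity. *)
Definition fl_reflect v x : 'cV[R]_n :=
  if v == 0 then x
  else fl_submul x (fl_mul F (fl_div F 2 (fl_dotv v v)) (fl_dotv v x)) v.

End FloatingPointKernels.

Section FloatingPointArnoldi.
Variables (R : realType) (eps : R) (F : fp_arith eps) (n : nat).
Variables (C : 'M[R]_n) (b : 'cV[R]_n).

(* Modified Gram-Schmidt with two orthogonalization passes at each step. *)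
Fixpoint fl_arnoldi_mgs2 j : seq 'cV[R]_n :=
  if j is j'.+1 then
    let s := fl_arnoldi_mgs2 j' in
    let w := fl_mulmx F C (last 0 s) in
    rcons s (fl_normalize F (fl_mgs_pass F s (fl_mgs_pass F s w)))
  else [:: fl_normalize F b].

(* P_0 (P_1 ( ... (P_j e_j))) for s = [:: v_0; ...; v_j], where P_i is the
   reflector of v_i: the last basis vector generated by s. *)
Definition fl_house_col (s : seq 'cV[R]_n) : 'cV[R]_n :=
  foldr (fun v x => fl_reflect F v x)
    (\col_i (i == (size s).-1 :> nat)%:R) s.

(* Householder Arnoldi process (Walker): the vectors v_0, ..., v_j, where v_j
   is the Householder vector of P_(j-1) ... P_0 C q for the last basis vector
   q, and v_0 that of b. *)
Fixpoint fl_arnoldi_house_vecs j : seq 'cV[R]_n :=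
  if j is j'.+1 then
    let s := fl_arnoldi_house_vecs j' in
    let z := foldl (fun x v => fl_reflect F v x)
               (fl_mulmx F C (fl_house_col s)) s in
    rcons s (fl_house F j z)
  else [:: fl_house F 0 b].

Definition fl_arnoldi_house k : seq 'cV[R]_n :=
  [seq fl_house_col (fl_arnoldi_house_vecs j) | j <- iota 0 k.+1].

End FloatingPointArnoldi.

Variant reorthogonalization := MGS2 | Householder.

Definition fl_arnoldi_matrix (R : realType) (eps : R) (F : fp_arith eps)
    (alg : reorthogonalization) n (C : 'M[R]_n) (b : 'cV[R]_n) k
    : 'M[R]_(n, k.+1) :=
  mx_of_cols k.+1
    (match alg with
     | MGS2 => fl_arnoldi_mgs2 F C b k
     | Householder => fl_arnoldi_house F C b k
     end).

(* Main.v *)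
Require Import Defs.
From HB Require Import structures.
From mathcomp Require Import all_boot all_order all_algebra.
From mathcomp Require Import all_classical all_reals all_analysis.
From mathcomp Require Import complex separable zify ring lra.
Set Implicit Arguments.
Unset Strict Implicit.
Unset Printing Implicit Defensive.

Import Order.TTheory GRing.Theory Num.Theory.
Import numFieldNormedType.Exports.
Local Open Scope classical_set_scope.
Local Open Scope ring_scope.

(** Exact process. The vector of the values and derivatives of a polynomial p
    at the nodes is mapped by C to the vector of 'X * p, and the starting vector
    is that of the constant 1. Hence the Arnoldi vectors are the vectors of
    polynomials p_0, p_1, ... with deg p_j = j. A nonzero polynomial of degree
    less than 2m cannot vanish to second order at m distinct nodes
    ([hermite_vec_eq0]), so no remainder is zero as long as k <= 2m - 1; the p_j
    are linearly independent because their vectors are orthonormal.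

    Condition number. If A is within d of a matrix with orthonormal columns,
    entry by entry, then the Gram matrix of A is within O(d) of the identity,
    and a Gershgorin argument puts every singular value within O(d) of 1
    ([kappa2_near_orthonormal]). It remains to show that the computed basis is
    within O(eps) of some matrix with orthonormal columns, with a constant that
    may depend on the nodes and on k. The two processes need different reasons.

    Householder: a backward argument, valid for every C and b. Applying a
    reflector in floating-point arithmetic commits an error O(eps) relative to
    the vector it is applied to, whatever the Householder vector is
    ([fl_reflect_err]); so the computed basis is within O(eps) of
    P_0 ... P_k [e_0, ..., e_k], where the P_l are the exact reflectors of the
    computed Householder vectors. Rounding errors in these vectors, and the
    discontinuous choice of sign made in computing them, change the orthonormal
    matrix that is approximated but not the bound on the distance to it.

    Modified Gram-Schmidt: a forward argument. The exact process does not break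
    down, so every operation of the floating-point process is Lipschitz near the
    values of the exact one, and the computed vectors are within O(eps) of the
    exact Arnoldi vectors ([approx_fl_arnoldi_mgs2]). In exact arithmetic both
    orthogonalization passes return the classical Gram-Schmidt remainder. *)

(** * The Euclidean inner product *)

Section DotProduct.
Variables (R : realType) (n : nat).
Implicit Types (u v w : 'cV[R]_n) (a : R).

Lemma dotvE u v : dotv u v = (u^T *m v) 0 0.
Proof. by rewrite mxE; apply: eq_bigr => i _; rewrite mxE. Qed.

Lemma dotvC u v : dotv u v = dotv v u.
Proof. by apply: eq_bigr => i _; rewrite mulrC. Qed.

Lemma dotvDr u v w : dotv u (v + w) = dotv u v + dotv u w.
Proof. by rewrite !dotvE mulmxDr mxE. Qed.

Lemma dotvBr u v w : dotv u (v - w) = dotv u v - dotv u w.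
Proof. by rewrite !dotvE mulmxBr !mxE. Qed.

Lemma dotvZr a u v : dotv u (a *: v) = a * dotv u v.
Proof. by rewrite !dotvE -scalemxAr mxE. Qed.

Lemma dotvBl u v w : dotv (u - v) w = dotv u w - dotv v w.
Proof. by rewrite !(dotvC _ w) dotvBr. Qed.

Lemma dotvZl a u v : dotv (a *: u) v = a * dotv u v.
Proof. by rewrite !(dotvC _ v) dotvZr. Qed.

Lemma dotv_sumr I (r : seq I) (f : I -> 'cV[R]_n) u :
  dotv u (\sum_(i <- r) f i) = \sum_(i <- r) dotv u (f i).
Proof.
elim/big_rec2: _ => [|i x y _ <-]; last exact: dotvDr.
by rewrite dotvE mulmx0 mxE.
Qed.

Lemma dotv_ge0 v : 0 <= dotv v v.
Proof. by apply: sumr_ge0 => i _; rewrite -expr2 sqr_ge0. Qed.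

Lemma dotv_gt0 v : (0 < dotv v v) = (v != 0).
Proof.
rewrite lt0r dotv_ge0 andbT psumr_eq0 => [|i _]; last by rewrite -expr2 sqr_ge0.
congr (~~ _); apply/allP/eqP => [v0|-> i _]; last by rewrite mxE mulr0 eqxx.
apply/colP => i; rewrite mxE.
by have := v0 i (mem_index_enum _); rewrite mulf_eq0 orbb => /eqP.
Qed.

Lemma dotv_delta (i j : 'I_n) :
  dotv (delta_mx i 0) (delta_mx j 0) = (i == j)%:R :> R.
Proof.
by rewrite dotvE trmx_delta mul_delta_mx_cond; case: (i == j); rewrite ?mulr1n !mxE.
Qed.

End DotProduct.

(** * Condition number of a nearly orthonormal matrix *)

(** Over the complex numbers an eigenvalue l and a row eigenvector v exist; the
    quadratic form v A v^* is real by symmetry and equals l times v v^* > 0, so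
    l is real. *)
Lemma symmetric_eigenvalue_exists (R : rcfType) n (A : 'M[R]_n) :
  (0 < n)%N -> A^T = A -> exists r, eigenvalue A r.
Proof.
move=> n_gt0 symA; pose f := @real_complex R.
have [l l_eig] := eigenvalue_closed (map_mx f A) n_gt0.
have /eigenvalueP [v vA v_neq0] := l_eig.
pose vc := (map_mx Num.conj v)^T.
have conjA : map_mx Num.conj (map_mx f A) = map_mx f A.
  apply/matrixP => i j; rewrite !mxE; apply/CrealP.
  by rewrite complex_real.
have normv : (v *m vc) 0 0 = \sum_i `|v 0 i| ^+ 2.
  by rewrite mxE; apply: eq_bigr => i _; rewrite !mxE normCK.
have normv_gt0 : 0 < (v *m vc) 0 0.
  have [i vi_neq0] : exists i, v 0 i != 0 by apply/rV0Pn.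
  rewrite normv (bigD1 i) //= ltr_wpDr ?exprn_gt0 ?normr_gt0 //.
  by apply: sumr_ge0 => j _; rewrite exprn_ge0.
have form : (v *m map_mx f A *m vc) 0 0 = l * (v *m vc) 0 0.
  by rewrite vA -scalemxAl mxE.
have form_real : ((v *m map_mx f A *m vc) 0 0)^* = (v *m map_mx f A *m vc) 0 0.
  transitivity ((map_mx Num.conj (v *m map_mx f A *m vc))^T 0 0).
    by rewrite !mxE.
  have vcK : map_mx Num.conj vc = v^T.
    by apply/matrixP => i j; rewrite !mxE conjCK.
  rewrite !map_mxM conjA vcK !trmx_mul trmxK map_trmx symA.
  by rewrite mulmxA.
have /complex_realP [r lr] : l \is Num.real.
  apply/CrealP; apply: (mulIf (lt0r_neq0 normv_gt0)).
  rewrite -form -form_real form rmorphM /=; congr (_ * _).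
  by apply/esym/CrealP/gtr0_real.
by exists r; rewrite -(eigenvalue_map f); rewrite lr in l_eig.
Qed.

(** Gershgorin: s ^ 2 - 1 is an eigenvalue of A^T A - 1, hence bounded by the row
    sums of its entries; and |s - 1| <= |s ^ 2 - 1| because s + 1 >= 1. *)
Lemma singular_value_near1 (R : realType) n p (A : 'M[R]_(n, p)) (d s : R) :
  (forall i j, `|(A^T *m A - 1%:M) i j| <= d) ->
  singular_values A s -> `|s - 1| <= p%:R * d.
Proof.
move=> gram_near [s_ge0 /eigenvalueP [v vG v_neq0]].
have p_gt0 : (0 < p)%N by case: (p) v v_neq0 {vG gram_near} => // v; rewrite thinmx0 eqxx.
pose i0 := Ordinal p_gt0.
(* the eigenvector equation is read off at an entry of largest modulus *)
pose i := [arg max_(i > i0) `|v 0 i|]%O.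
have v_max j : `|v 0 j| <= `|v 0 i|.
  by rewrite /i; case: arg_maxP => //= k _; apply.
have vi_gt0 : 0 < `|v 0 i|.
  have [j vj] : exists j, v 0 j != 0 by apply/rV0Pn.
  by apply: lt_le_trans (v_max j); rewrite normr_gt0.
have row_i : (s ^+ 2 - 1) * v 0 i = \sum_j v 0 j * (A^T *m A - 1%:M) j i.
  transitivity ((v *m (A^T *m A - 1%:M)) 0 i); last by rewrite mxE.
  by rewrite mulmxBr vG mulmx1 !mxE mulrBl mul1r.
have s2_near : `|s ^+ 2 - 1| <= p%:R * d.
  rewrite -(ler_pM2r vi_gt0) -normrM row_i.
  apply: le_trans (ler_norm_sum _ _ _) _.
  apply: (@le_trans _ _ (\sum_(j < p) `|v 0 i| * d)).
    by apply: ler_sum => j _; rewrite normrM ler_pM.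
  by rewrite sumr_const card_ord -[leLHS]mulr_natl -mulrA (mulrC d).
apply: le_trans s2_near.
have -> : s ^+ 2 - 1 = (s - 1) * (s + 1) by ring.
by rewrite normrM ler_peMr // ger0_norm; lra.
Qed.

(** Without this lemma the supremum and the infimum that define [kappa2] could be
    those of the empty set, that is 0. *)
Lemma singular_values_nonempty (R : realType) n p (A : 'M[R]_(n, p)) :
  (0 < p)%N -> singular_values A !=set0.
Proof.
move=> p_gt0.
have [r r_eig] : exists r, eigenvalue (A^T *m A) r.
  by apply: symmetric_eigenvalue_exists; rewrite // trmx_mul trmxK.
have /eigenvalueP [v vG v_neq0] := r_eig.
have sq_sum m (x : 'rV[R]_m) : (x *m x^T) 0 0 = \sum_i x 0 i ^+ 2.
  by rewrite mxE; apply: eq_bigr => i _; rewrite mxE expr2.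
have form : r * (v *m v^T) 0 0 = ((v *m A^T) *m (v *m A^T)^T) 0 0.
  by rewrite trmx_mul trmxK mulmxA -(mulmxA v) vG -scalemxAl [RHS]mxE.
have r_ge0 : 0 <= r.
  have v_gt0 : 0 < (v *m v^T) 0 0.
    have [i vi] : exists i, v 0 i != 0 by apply/rV0Pn.
    rewrite sq_sum (bigD1 i) //= ltr_wpDr ?exprn_even_gt0 //.
    by apply: sumr_ge0 => j _; rewrite sqr_ge0.
  rewrite -(pmulr_lge0 _ v_gt0) form sq_sum.
  by apply: sumr_ge0 => j _; rewrite sqr_ge0.
by exists (Num.sqrt r); split; rewrite ?sqrtr_ge0 ?sqr_sqrtr.
Qed.

(** The extreme singular values differ by at most 2 p d, and the smallest one is at
    least 1 / 2. *)
Lemma kappa2_near1 (R : realType) n p (A : 'M[R]_(n, p)) (d : R) :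
  (0 < p)%N -> (forall i j, `|(A^T *m A - 1%:M) i j| <= d) ->
  p%:R * d <= 2^-1 ->
  0 < sigma_min A /\ `|kappa2 A - 1| <= 4 * (p%:R * d).
Proof.
move=> p_gt0 gram_near small; set e := p%:R * d in small *.
have near1 s : singular_values A s -> 1 - e <= s <= 1 + e.
  by move=> /(singular_value_near1 gram_near); rewrite ler_distl.
have ne := singular_values_nonempty A p_gt0.
have lo : 1 - e <= sigma_min A.
  by apply: lb_le_inf => // s /near1 /andP[].
have hi : sigma_max A <= 1 + e.
  by apply: ge_sup => // s /near1 /andP[].
have le_mM : sigma_min A <= sigma_max A.
  have [s sA] := ne; apply: (@le_trans _ _ s).
    by apply: ge_inf => //; exists (1 - e) => x /near1 /andP[].
  by apply: ub_le_sup => //; exists (1 + e) => x /near1 /andP[].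
have min_gt0 : 0 < sigma_min A by lra.
split=> //; rewrite /kappa2.
have -> : sigma_max A / sigma_min A - 1 = (sigma_max A - sigma_min A) / sigma_min A.
  by field; rewrite gt_eqF.
rewrite ger0_norm; last by rewrite divr_ge0 ?subr_ge0 // ltW.
rewrite ler_pdivrMr //; nra.
Qed.

(** The entries of P are at most 1 in modulus, so each entry of A^T A differs
    from that of P^T P by at most n (d ^ 2 + 2 d) <= 3 n d. *)
Lemma kappa2_near_orthonormal (R : realType) n p (A P : 'M[R]_(n, p)) (d : R) :
  (0 < p)%N -> P^T *m P = 1%:M -> (forall i j, `|A i j - P i j| <= d) ->
  6 * n%:R * p%:R * d <= 1 -> d <= 1 ->
  0 < sigma_min A /\ `|kappa2 A - 1| <= 12 * n%:R * p%:R * d.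
Proof.
move=> p_gt0 orthP near small d_le1.
have P_le1 i j : `|P i j| <= 1.
  have : (P^T *m P) j j = 1 by rewrite orthP mxE eqxx.
  rewrite mxE (bigD1 i) //= mxE => sum1.
  rewrite -(@ler_pXn2r _ 2) // ?nnegrE // expr1n real_normK ?num_real // -sum1.
  by rewrite expr2 lerDl; apply: sumr_ge0 => l _; rewrite mxE -expr2 sqr_ge0.
have gram i j : `|(A^T *m A - 1%:M) i j| <= 3 * n%:R * d.
  have -> : (A^T *m A - 1%:M) i j = \sum_l (A l i * A l j - P l i * P l j).
    rewrite -orthP mxE [X in _ + X]mxE !(mxE _ (fun _ _ => bigop _ _ _)) -sumrB.
    by apply: eq_bigr => l _; rewrite !mxE.
  apply: le_trans (ler_norm_sum _ _ _) _.
  have -> : 3 * n%:R * d = \sum_(l < n) (3 * d).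
    by rewrite sumr_const card_ord -mulr_natl; ring.
  apply: ler_sum => l _.
  have -> : A l i * A l j - P l i * P l j =
    (A l i - P l i) * (A l j - P l j) + (A l i - P l i) * P l j
      + P l i * (A l j - P l j) by ring.
  apply: le_trans (ler_normD _ _) _; apply: le_trans (lerD (ler_normD _ _) (lexx _)) _.
  rewrite !normrM.
  have -> : 3 * d = d * 1 + d * 1 + 1 * d by ring.
  have nearl := (near l i, near l j, P_le1 l i, P_le1 l j).
  have le1 : `|A l j - P l j| <= 1 by apply: le_trans d_le1.
  by rewrite !lerD // ler_pM // nearl.
have [] := kappa2_near1 p_gt0 gram; first by lra.
by move=> min_gt0 bound; split=> //; apply: le_trans bound _; lra.
Qed.

(** * Orthonormal lists and the exact Arnoldi process *)

Section Orthonormal.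
Variables (R : realType) (n : nat).
Implicit Types (s : seq 'cV[R]_n) (q u w : 'cV[R]_n).

Definition orthonormal s :=
  all (fun u => dotv u u == 1) s && pairwise (fun u v => dotv u v == 0) s.

Lemma orthonormal_rcons s w :
  orthonormal (rcons s w) =
  [&& dotv w w == 1, all (fun q => dotv q w == 0) s & orthonormal s].
Proof.
rewrite /orthonormal all_rcons pairwise_rcons -!andbA; do !bool_congr.
Qed.

Definition project_out s w := w - \sum_(q <- s) dotv q w *: q.

Lemma project_out_orthogonal s w :
  orthonormal s -> {in s, forall q : 'cV[R]_n, dotv q (project_out s w) = 0}.
Proof.
move=> /andP[unit_s]; rewrite /project_out => orth_s q qs; apply/eqP.
rewrite dotvBr dotv_sumr subr_eq0 eq_sym; apply/eqP.
under eq_bigr do rewrite dotvZr.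
elim: s unit_s orth_s qs => //= p s IHs /andP[/eqP p1 unit_s] /andP[/allP p_s orth_s].
rewrite inE big_cons => /predU1P[->|qs].
  rewrite p1 mulr1 big_seq big1 ?addr0 // => v /p_s /eqP vp.
  by rewrite vp mulr0.
have /eqP pq := p_s q qs.
by rewrite (dotvC q) pq mulr0 add0r IHs.
Qed.

(** The second orthogonalization pass has no effect in exact arithmetic. *)
Lemma project_out_idem s w :
  orthonormal s -> project_out s (project_out s w) = project_out s w.
Proof.
move=> orth_s; rewrite [LHS]/project_out big_seq big1 ?subr0 // => q qs.
by rewrite project_out_orthogonal ?scale0r.
Qed.

(** Subtracting the component along one vector of an orthonormal list does not
    change the inner products with the others, so the modified and the classical
    Gram-Schmidt coefficients agree. *)
Lemma mgs_pass_exact s w : orthonormal s ->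
  foldl (fun w q => w - dotv q w *: q) w s = project_out s w.
Proof.
move=> /andP[_]; rewrite /project_out; elim: s w => [|p s IHs] w /=.
  by rewrite big_nil subr0.
move=> /andP[/allP p_s orth_s]; rewrite IHs // big_cons opprD addrA; congr (_ - _).
rewrite big_seq [RHS]big_seq; apply: eq_bigr => q /p_s /eqP qp.
by rewrite dotvBr dotvZr dotvC (dotvC q p) qp mulr0 subr0 dotvC.
Qed.

Lemma dotv_normalize w : w != 0 -> dotv (normalize w) (normalize w) = 1.
Proof.
move=> w_neq0; have w_gt0 : 0 < dotv w w by rewrite dotv_gt0.
rewrite dotvZl dotvZr mulrA -invfM -expr2 sqr_sqrtr ?dotv_ge0 //.
by rewrite mulVf // gt_eqF.
Qed.

Lemma orthonormal_extend s w :
  orthonormal s -> project_out s w != 0 ->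
  orthonormal (rcons s (normalize (project_out s w))).
Proof.
move=> orth_s r_neq0; rewrite orthonormal_rcons dotv_normalize // eqxx orth_s andbT.
apply/allP => q qs; rewrite dotvZr.
by rewrite (project_out_orthogonal _ orth_s) ?mulr0.
Qed.

Lemma dotv_orthonormal s i j : orthonormal s ->
  (i < size s)%N -> (j < size s)%N -> dotv s`_i s`_j = (i == j)%:R.
Proof.
move=> /andP[/allP unit_s /(pairwiseP 0) orth_s] lt_i lt_j.
case: ltngtP => [lt_ij|lt_ji|<-]; last by apply/eqP/unit_s/mem_nth.
  by apply/eqP; exact: orth_s.
by rewrite dotvC; apply/eqP; exact: orth_s.
Qed.

Lemma orthonormal_matrix s p : orthonormal s -> size s = p ->
  (mx_of_cols p s)^T *m mx_of_cols p s = 1%:M.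
Proof.
move=> orth_s size_s; apply/matrixP => i j; rewrite [RHS]mxE.
transitivity (dotv s`_i s`_j); last by rewrite dotv_orthonormal ?size_s.
by rewrite mxE; apply: eq_bigr => l _; rewrite !mxE.
Qed.

Lemma size_arnoldi (C : 'M[R]_n) b j : size (arnoldi C b j) = j.+1.
Proof. by elim: j => //= j IHj; rewrite size_rcons IHj. Qed.

Lemma arnoldi_remainder_project (C : 'M[R]_n) s :
  arnoldi_remainder C s = project_out s (C *m last 0 s).
Proof. by []. Qed.

Lemma arnoldi_orthonormal (C : 'M[R]_n) b k : b != 0 ->
  arnoldi_no_breakdown C b k -> orthonormal (arnoldi C b k).
Proof.
move=> b_neq0; elim: k => [|k IHk] no_bd /=.
  by rewrite /orthonormal /= dotv_normalize // eqxx.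
apply: orthonormal_extend; last exact: no_bd.
by apply: IHk => j lt_jk; apply: no_bd; exact: ltnW.
Qed.

End Orthonormal.

(** * Hermite data of polynomials and the confluent operator *)

Section HermiteVectors.
Variables (R : realType) (m : nat) (t : 'I_m -> R).
Implicit Types (p : {poly R}).

(** The column that a polynomial contributes to a Hermite basis matrix. *)
Definition hermite_vec p : 'cV[R]_(m + m) :=
  col_mx (\col_i p.[t i]) (\col_i p^`().[t i]).

Lemma hermite_vec_linear : linear hermite_vec.
Proof.
move=> a p q; rewrite /hermite_vec scale_col_mx add_col_mx.
by congr col_mx; apply/colP => i; rewrite !mxE ?derivD ?derivZ hornerD hornerZ.
Qed.

HB.instance Definition _ :=
  GRing.isLinear.Build R {poly R} 'cV[R]_(m + m) _ hermite_vec hermite_vec_linear.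

(** The lower half is the product rule ('X * p)' = p + 'X * p'; this is what the
    identity block of the operator is for. *)
Lemma mul_confluent_operator p :
  confluent_operator t *m hermite_vec p = hermite_vec ('X * p).
Proof.
rewrite /confluent_operator /hermite_vec mul_block_col mul0mx addr0 mul1mx.
rewrite !mul_diag_mx; congr col_mx; apply/colP => i; rewrite !mxE.
  by rewrite hornerM hornerX.
by rewrite derivM derivX mul1r hornerD hornerM hornerX.
Qed.

Lemma hermite_vec1 : hermite_vec 1 = start_vector R m.
Proof.
rewrite /hermite_vec /start_vector; congr col_mx; apply/colP => i; rewrite !mxE.
  by rewrite hornerC.
by rewrite derivC horner0.
Qed.

(** With w the product of the 'X - t_i, p vanishing at the nodes gives p = q * w;
    then p' = q * w' at the nodes, where w' does not vanish since w is separable,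
    so q vanishes there too. Hence w ^ 2, of degree 2m, divides p. *)
Lemma hermite_vec_eq0 p : injective t -> (size p <= m + m)%N ->
  hermite_vec p = 0 -> p = 0.
Proof.
move=> t_inj size_p vec0.
have p0 i : p.[t i] = 0.
  by have /colP /(_ (lshift m i)) := vec0; rewrite col_mxEu !mxE.
have p'0 i : p^`().[t i] = 0.
  by have /colP /(_ (rshift m i)) := vec0; rewrite col_mxEd !mxE.
pose ts := codom t; have ts_uniq : uniq ts by apply/injectiveP.
have size_ts : size ts = m by rewrite size_codom card_ord.
pose w := \prod_(x <- ts) ('X - x%:P).
have dvdw q : (forall i, q.[t i] = 0) -> w %| q.
  move=> q0; apply: uniq_roots_dvdp; last by rewrite uniq_rootsE.
  by apply/allP => _ /codomP[i ->]; apply/rootP.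
have /dvdpP[q pE] := dvdw p p0.
have w'_neq0 i : w^`().[t i] != 0.
  have : separable_poly w by rewrite separable_prod_XsubC.
  rewrite unlock => /coprimep_root; apply.
  by rewrite root_prod_XsubC codom_f.
have /dvdpP[r qE] : w %| q.
  apply: dvdw => i; apply/eqP; rewrite -(mulIr_eq0 _ (mulIf (w'_neq0 i))).
  have := p'0 i; rewrite pE derivM hornerD !hornerM.
  have /rootP -> : root w (t i) by rewrite root_prod_XsubC codom_f.
  by rewrite mulr0 add0r => ->.
have w_neq0 : w != 0 by rewrite monic_neq0 ?monic_prod_XsubC.
have size_w : size w = m.+1 by rewrite size_prod_XsubC size_ts.
apply/eqP; apply: contraLR size_p => p_neq0; rewrite -ltnNge.
have r_neq0 : r != 0 by apply: contraNneq p_neq0 => r0; rewrite pE qE r0 !mul0r.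
have r_gt0 : (0 < size r)%N by rewrite size_poly_gt0.
rewrite pE qE size_mul ?mulf_neq0 // size_mul // size_w.
by case: (size r) r_gt0 => // l _; rewrite addSn !addnS /=; lia.
Qed.

End HermiteVectors.

Section ConfluentArnoldi.
Variables (R : realType) (m : nat) (t : 'I_m -> R).
Hypothesis t_inj : injective t.
Local Notation C := (confluent_operator t).
Local Notation b := (start_vector R m).
Local Notation vec := (hermite_vec t).

(** The leading term of 'X * p, for the last polynomial p, survives the
    subtraction of multiples of polynomials of lower degree. *)
Lemma arnoldi_remainder_polynomial (ps : seq {poly R}) :
  let rs := arnoldi_remainder C (map vec ps) in
  ps != [::] -> (forall i, (i < size ps)%N -> size ps`_i = i.+1) ->
  exists2 r : {poly R}, rs = vec r & size r = (size ps).+1.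
Proof.
case/lastP: ps => // ps p rs _ size_ps.
have size_p : size p = (size ps).+1.
  by have := size_ps (size ps); rewrite nth_rcons ltnn eqxx size_rcons; apply.
pose w := C *m last 0 (map vec (rcons ps p)).
exists ('X * p - \sum_(q <- rcons ps p) dotv (vec q) w *: q).
  rewrite /rs arnoldi_remainder_project /project_out linearB [X in _ = _ - X]linear_sum /= big_map.
  congr (_ - _); first by rewrite map_rcons last_rcons mul_confluent_operator.
  by apply: eq_bigr => q _; rewrite linearZ.
have p_neq0 : p != 0 by rewrite -size_poly_gt0 size_p.
have size_Xp : size ('X * p) = (size ps).+2 by rewrite mulrC size_mulX // size_p.
rewrite size_polyDl ?size_Xp ?size_rcons // size_polyN ltnS.
rewrite (big_nth 0) size_rcons; apply: leq_trans (size_sum _ _ _) _.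
apply/bigmax_leqP_seq => i; rewrite mem_index_iota => /andP[_ lt_i] _.
by apply: leq_trans (size_scale_leq _ _) _; rewrite size_ps ?size_rcons.
Qed.

Lemma start_vector_neq0 : (0 < m)%N -> b != 0.
Proof.
move=> m_gt0; apply/eqP => /colP /(_ (lshift m (Ordinal m_gt0))) /eqP.
by rewrite col_mxEu !mxE oner_eq0.
Qed.

Lemma arnoldi_remainder_neq0 (ps : seq {poly R}) :
  ps != [::] -> (forall i, (i < size ps)%N -> size ps`_i = i.+1) ->
  (size ps < m + m)%N -> arnoldi_remainder C (map vec ps) != 0.
Proof.
move=> ps_ne deg_ps lt_ps; have [r -> size_r] := arnoldi_remainder_polynomial ps_ne deg_ps.
apply/eqP => /(hermite_vec_eq0 t_inj); rewrite size_r => /(_ lt_ps) r0.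
by move: size_r; rewrite r0 size_poly0.
Qed.

Lemma arnoldi_polynomials j : (j < m + m)%N ->
  exists ps : seq {poly R}, [/\ arnoldi C b j = map vec ps, size ps = j.+1 &
    forall i, (i < size ps)%N -> size ps`_i = i.+1].
Proof.
have normV_neq0 v : v != 0 -> (norm2 v)^-1 != 0 :> R.
  by rewrite invr_eq0 sqrtr_eq0 -ltNge dotv_gt0.
elim: j => [|j IHj] lt_j.
  have b_neq0 : b != 0 by apply: start_vector_neq0; lia.
  exists [:: (norm2 b)^-1 *: 1]; split=> //=.
    by rewrite linearZ /= hermite_vec1.
  by case=> // _ /=; rewrite size_scale ?size_poly1 ?normV_neq0.
have [ps [arn_ps size_ps deg_ps]] := IHj (ltnW lt_j).
have ps_ne : ps != [::] by rewrite -size_eq0 size_ps.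
have [r rE size_r] := arnoldi_remainder_polynomial ps_ne deg_ps.
have r_neq0 := arnoldi_remainder_neq0 ps_ne deg_ps; rewrite size_ps lt_j in r_neq0.
exists (rcons ps ((norm2 (arnoldi_remainder C (map vec ps)))^-1 *: r)); split.
- by rewrite /= arn_ps map_rcons linearZ /= -rE.
- by rewrite size_rcons size_ps.
- move=> i; rewrite size_rcons nth_rcons ltnS leq_eqVlt => /predU1P[->|lt_i].
    by rewrite ltnn eqxx size_scale // normV_neq0 // r_neq0.
  by rewrite lt_i deg_ps.
Qed.

Lemma arnoldi_no_breakdown_confluent k : (k < m + m)%N -> arnoldi_no_breakdown C b k.
Proof.
move=> lt_k j lt_jk; have lt_j : (j.+1 < m + m)%N by apply: leq_ltn_trans lt_k.
have [ps [-> size_ps deg_ps]] := arnoldi_polynomials (ltnW lt_j).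
have ps_ne : ps != [::] by rewrite -size_eq0 size_ps.
by apply: arnoldi_remainder_neq0; rewrite // size_ps.
Qed.

(** Linear independence of the k + 1 polynomials is inherited from that of their
    orthonormal vectors, and dimension does the rest. *)
Lemma hermite_basis_arnoldi k : (k < m + m)%N ->
  hermite_basis_matrix t (arnoldi_matrix C b k).
Proof.
move=> lt_k; have [ps [arn_ps size_ps deg_ps]] := arnoldi_polynomials lt_k.
have orth : orthonormal (arnoldi C b k).
  apply: arnoldi_orthonormal (arnoldi_no_breakdown_confluent lt_k).
  by apply: start_vector_neq0; lia.
pose p := [tuple npolyp k.+1 ps`_j | j < k.+1].
have pE j : tnth p j = ps`_j :> {poly R}.
  by rewrite tnth_mktuple npolypK // deg_ps ?size_ps.
exists p; last first.
  move=> i j; rewrite !pE !mxE arn_ps (nth_map 0) ?size_ps //.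
  by rewrite /hermite_vec col_mxEu col_mxEd !mxE.
rewrite basisEfree subvf size_tuple dim_polyn leqnn !andbT.
apply/freeP => c sum0 i.
have vec_sum0 : \sum_j c j *: vec ps`_j = 0.
  transitivity (vec (val (\sum_j c j *: (p`_j : {poly_k.+1 R})))).
    rewrite (@big_morph _ _ val 0%R +%R) // linear_sum; apply: eq_bigr => j _.
    by rewrite -pE (tnth_nth 0) -linearZ.
  by rewrite sum0 linear0.
have vec_dot (j : 'I_k.+1) : dotv (vec ps`_i) (vec ps`_j) = (i == j)%:R.
  have nthE (l : 'I_k.+1) : vec ps`_l = (arnoldi C b k)`_l.
    by rewrite arn_ps (nth_map 0) ?size_ps.
  by rewrite !nthE dotv_orthonormal ?size_arnoldi.
have := congr1 (dotv (vec ps`_i)) vec_sum0.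
rewrite dotv_sumr (bigD1 i) //= big1 => [|j j_neq_i].
  by rewrite dotvZr vec_dot eqxx mulr1 addr0 => ->; rewrite dotvE mulmx0 mxE.
by rewrite dotvZr vec_dot eq_sym (negPf j_neq_i) mulr0.
Qed.

End ConfluentArnoldi.

(** * Rounding errors of sums and inner products *)

Lemma near_mul_le1 (R : realType) (M : R) : \forall eps \near (0 : R)^'+, M * eps <= 1.
Proof.
have [M_le0|M_gt0] := leP M 0; near=> eps.
  have eps_gt0 : 0 < eps by near: eps; exact: nbhs_right_gt.
  by apply: le_trans ler01; rewrite mulr_le0_ge0 // ltW.
rewrite mulrC -ler_pdivlMr // div1r.
by near: eps; apply: nbhs_right_le; rewrite invr_gt0.
Unshelve. all: by end_near. Qed.

Section Kernels.
Variables (R : realType) (eps : R) (F : fp_arith eps).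
Hypothesis eps_le1 : eps <= 1.

Lemma eps_ge0 : 0 <= eps.
Proof. by have [d d_le _] := fl_addP F 0 0; apply: le_trans d_le. Qed.

(** Induction on the tree: an addition at most doubles the errors of its two
    operands, which are shorter sums, and adds eps times the exact sum. The
    constant 2 ^ size - 1 is far from optimal but does not depend on the
    bracketing. *)
Lemma sum_tree_err (s : seq R) (x : R) : sum_tree (fl_add F) s x ->
  `|x - \sum_(y <- s) y| <= (2 ^+ size s - 1) * (eps * \sum_(y <- s) `|y|).
Proof.
have [e0 e1] := (eps_ge0, eps_le1).
elim=> {s x} [|x|s s1 s2 x1 x2 s_eq s1_ne s2_ne _ IH1 _ IH2].
- by rewrite !big_nil subrr normr0 mulr0 mulr0.
- by rewrite !big_seq1 subrr normr0 /= expr1 mulr_ge0 ?mulr_ge0 ?normr_ge0 //; lra.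
have split_sum (f : R -> R) :
    \sum_(y <- s) f y = \sum_(y <- s1) f y + \sum_(y <- s2) f y.
  by rewrite (perm_big _ s_eq) big_cat.
rewrite !split_sum (perm_size s_eq) size_cat.
set S1 := \sum_(y <- s1) y in IH1 *; set S2 := \sum_(y <- s2) y in IH2 *.
set T1 := \sum_(y <- s1) `|y| in IH1 *; set T2 := \sum_(y <- s2) `|y| in IH2 *.
have S1_le : `|S1| <= T1 by exact: ler_norm_sum.
have S2_le : `|S2| <= T2 by exact: ler_norm_sum.
set c := 2 ^+ (size s1 + size s2).
have c_ge n : (n.+1 <= size s1 + size s2)%N -> 2 * 2 ^+ n <= c.
  by move=> le_n; rewrite -exprS ler_eXn2l // ltr1n.
have c1 : 2 * 2 ^+ size s1 <= c.
  by apply: c_ge; rewrite -addn1 leq_add2l lt0n size_eq0.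
have c2 : 2 * 2 ^+ size s2 <= c.
  by apply: c_ge; rewrite -add1n leq_add2r lt0n size_eq0.
have [d d_le ->] := fl_addP F x1 x2.
have -> : (x1 + x2) * (1 + d) - (S1 + S2) =
  (x1 - S1) * (1 + d) + (x2 - S2) * (1 + d) + (S1 + S2) * d by ring.
have d1_le : `|1 + d| <= 2.
  by apply: le_trans (ler_normD _ _) _; rewrite normr1 -[2]/(1 + 1) lerD2l (le_trans d_le).
apply: le_trans (ler_normD _ _) _.
apply: le_trans (lerD (ler_normD _ _) (lexx _)) _; rewrite !normrM.
have h1 : `|x1 - S1| * `|1 + d| <= (2 * 2 ^+ size s1 - 2) * (eps * T1).
  have -> : (2 * 2 ^+ size s1 - 2) * (eps * T1)
    = (2 ^+ size s1 - 1) * (eps * T1) * 2 by ring.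
  exact: ler_pM.
have h2 : `|x2 - S2| * `|1 + d| <= (2 * 2 ^+ size s2 - 2) * (eps * T2).
  have -> : (2 * 2 ^+ size s2 - 2) * (eps * T2)
    = (2 ^+ size s2 - 1) * (eps * T2) * 2 by ring.
  exact: ler_pM.
have h3 : `|S1 + S2| * `|d| <= (T1 + T2) * eps.
  by apply: ler_pM => //; apply: le_trans (ler_normD _ _) _; apply: lerD.
have eT1 : 0 <= eps * T1 by rewrite mulr_ge0 ?sumr_ge0.
have eT2 : 0 <= eps * T2 by rewrite mulr_ge0 ?sumr_ge0.
move: eT1 eT2 h1 h2 h3 c1 c2 {c_ge}.
move: (2 ^+ size s1) (2 ^+ size s2) c => p1 p2 c eT1 eT2 h1 h2 h3 c1 c2.
have h1' : (2 * p1 - 2) * (eps * T1) <= (c - 2) * (eps * T1) by rewrite ler_wpM2r // lerB.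
have h2' : (2 * p2 - 2) * (eps * T2) <= (c - 2) * (eps * T2) by rewrite ler_wpM2r // lerB.
lra.
Qed.

(** The bound scales with u and v, because [fl_reflect_err] applies it to
    Householder vectors of arbitrary length. *)
Lemma fl_dotv_err n (u v : 'cV[R]_n) :
  `|fl_dotv F u v - dotv u v|
    <= 2 ^+ n.+1 * eps * \sum_i `|u i 0 * v i 0|.
Proof.
have [e0 e1] := (eps_ge0, eps_le1); rewrite /fl_dotv /dotv.
set s := [seq _ | _ <- _].
have := sum_tree_err (fl_sumP F s).
have -> : size s = n by rewrite size_map -cardE card_ord.
have sum_s f : \sum_(y <- s) f y = \sum_i f (fl_mul F (u i 0) (v i 0)) :> R.
  by rewrite big_map big_enum.
rewrite !sum_s => err.
have prod_err i : `|fl_mul F (u i 0) (v i 0) - u i 0 * v i 0|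
    <= eps * `|u i 0 * v i 0|.
  have [d d_le ->] := fl_mulP F (u i 0) (v i 0).
  by rewrite -[X in _ - X]mulr1 -mulrBr addrAC subrr add0r normrM mulrC ler_wpM2r.
set T := \sum_i `|_ * _|.
have sum_le : \sum_i `|fl_mul F (u i 0) (v i 0)| <= 2 * T.
  rewrite mulr_sumr; apply: ler_sum => i _.
  have := prod_err i; have := ler_normD (fl_mul F (u i 0) (v i 0) - u i 0 * v i 0) (u i 0 * v i 0).
  rewrite subrK; have := normr_ge0 (u i 0 * v i 0); nra.
have sum_err : `|\sum_i fl_mul F (u i 0) (v i 0) - \sum_i u i 0 * v i 0| <= eps * T.
  rewrite -sumrB mulr_sumr; apply: le_trans (ler_norm_sum _ _ _) _.
  by apply: ler_sum => i _.
have T_ge0 : 0 <= T by apply: sumr_ge0.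
have c_ge1 : 1 <= 2 ^+ n :> R by rewrite exprn_ege1 ?ler1n.
apply: le_trans (ler_distD (\sum_i fl_mul F (u i 0) (v i 0)) _ _) _.
rewrite exprS.
have : (2 ^+ n - 1) * (eps * \sum_i `|fl_mul F (u i 0) (v i 0)|)
   <= (2 ^+ n - 1) * (eps * (2 * T)).
  by rewrite !ler_wpM2l // subr_ge0.
have : 0 <= eps * T by rewrite mulr_ge0.
lra.
Qed.

End Kernels.

(** * Householder reflections *)

Section Householder.
Variables (R : realType) (n : nat).
Implicit Types (v x y : 'cV[R]_n).

Definition norm1 x : R := \sum_i `|x i 0|.

(** For v = 0 this is the identity, since x / 0 = 0: the same convention as in
    [fl_reflect]. *)
Definition reflection v x : 'cV[R]_n := x - (2 * dotv v x / dotv v v) *: v.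

Lemma reflection0 x : reflection 0 x = x.
Proof. by rewrite /reflection scaler0 subr0. Qed.

Lemma reflectionB v x y : reflection v (x - y) = reflection v x - reflection v y.
Proof.
rewrite /reflection dotvBr mulrBr mulrBl scalerBl.
by rewrite !opprD !opprK addrACA.
Qed.

Lemma reflection_isometry v x y : dotv (reflection v x) (reflection v y) = dotv x y.
Proof.
have [->|v_neq0] := eqVneq v 0; first by rewrite !reflection0.
rewrite /reflection !dotvBl !dotvBr !dotvZl !dotvZr (dotvC x v).
by field; rewrite gt_eqF ?dotv_gt0.
Qed.

Lemma reflection_delta v (i : 'I_n) :
  v i 0 = 0 -> reflection v (delta_mx i 0) = delta_mx i 0.
Proof.
move=> vi0; rewrite /reflection; suff -> : dotv v (delta_mx i 0) = 0.
  by rewrite mulr0 mul0r scale0r subr0.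
rewrite /dotv big1 // => j _; rewrite !mxE eqxx andbT.
by case: (eqVneq j i) => [->|]; rewrite ?vi0 ?mul0r ?mulr0.
Qed.

Lemma norm1_ge0 x : 0 <= norm1 x.
Proof. exact: sumr_ge0. Qed.

Lemma norm1_0 : norm1 0 = 0.
Proof. by rewrite /norm1 big1 // => i _; rewrite mxE normr0. Qed.

Lemma norm1D x y : norm1 (x + y) <= norm1 x + norm1 y.
Proof. by rewrite -big_split; apply: ler_sum => i _; rewrite mxE ler_normD. Qed.

Lemma entry_norm1 x i : `|x i 0| <= norm1 x.
Proof. by rewrite /norm1 (bigD1 i) //= lerDl sumr_ge0. Qed.

Lemma norm1_le x (c : R) : (forall i, `|x i 0| <= c) -> norm1 x <= n%:R * c.
Proof.
move=> x_le; apply: le_trans (ler_sum _ (fun i _ => x_le i)) _.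
by rewrite sumr_const card_ord mulr_natl.
Qed.

Lemma norm1_delta (i : 'I_n) : norm1 (delta_mx i 0) = 1.
Proof.
rewrite /norm1 (bigD1 i) //= big1 ?mxE ?eqxx ?normr1 ?addr0 // => j ji.
by rewrite mxE (negPf ji) normr0.
Qed.

(** Bounds v_i <v, x> / <v, v> independently of the length of v; it follows from
    |v_i| |v_j| <= (v_i ^ 2 + v_j ^ 2) / 2 <= <v, v>. *)
Lemma entry_mul_abs_dotv v x i :
  `|v i 0| * (\sum_j `|v j 0 * x j 0|) <= dotv v v * norm1 x.
Proof.
have sq_le j : v j 0 ^+ 2 <= dotv v v.
  by rewrite /dotv (bigD1 j) //= -expr2 lerDl; apply: sumr_ge0 => l _; rewrite -expr2 sqr_ge0.
rewrite !mulr_sumr; apply: ler_sum => j _; rewrite normrM mulrA ler_wpM2r //.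
have := sq_le i; have := sq_le j.
rewrite -(real_normK (num_real (v i 0))) -(real_normK (num_real (v j 0))).
have := sqr_ge0 (`|v i 0| - `|v j 0|); lra.
Qed.

Lemma norm1_reflection v x : norm1 (reflection v x) <= n%:R * (3 * norm1 x).
Proof.
apply: norm1_le => i; have [->|v_neq0] := eqVneq v 0.
  by rewrite reflection0; apply: le_trans (entry_norm1 x i) _; have := norm1_ge0 x; lra.
have v_gt0 : 0 < dotv v v by rewrite dotv_gt0.
rewrite !mxE; apply: le_trans (ler_normB _ _) _.
have : `|2 * dotv v x / dotv v v * v i 0| <= 2 * norm1 x.
  rewrite normrM normf_div (gtr0_norm v_gt0) mulrAC ler_pdivrMr //.
  rewrite normrM ger0_norm // -!mulrA ler_pM2l // mulrC.
  rewrite (mulrC _ (dotv v v)); apply: le_trans (entry_mul_abs_dotv v x i).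
  by rewrite ler_wpM2l // ler_norm_sum.
by have := entry_norm1 x i; lra.
Qed.

End Householder.

Lemma rel_err_mul (R : realType) (d1 d2 e1 e2 : R) :
  `|d1| <= e1 -> `|d2| <= e2 -> e2 <= 1 ->
  `|(1 + d1) * (1 + d2) - 1| <= 2 * e1 + e2.
Proof.
move=> d1_le d2_le e2_le; have -> : (1 + d1) * (1 + d2) - 1 = d1 + d2 + d1 * d2 by ring.
apply: le_trans (ler_normD _ _) _; apply: le_trans (lerD (ler_normD _ _) (lexx _)) _.
have : `|d1 * d2| <= e1 * 1.
  by rewrite normrM ler_pM //; apply: le_trans e2_le.
lra.
Qed.

(** The error is relative to x alone, uniformly in v. The computed <v, v> has a
    relative error, because all its terms are nonnegative; the error of the
    computed <v, x> may be large relative to <v, x>, but once multiplied by v_i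
    and divided by <v, v> it is O(eps) |x| by [entry_mul_abs_dotv]. *)
Lemma fl_reflect_err (R : realType) (eps : R) (F : fp_arith eps) n
    (v x : 'cV[R]_n) (i : 'I_n) :
  2 ^+ n.+1 * eps <= 2^-1 ->
  `|fl_reflect F v x i 0 - reflection v x i 0| <= 62 * (2 ^+ n.+1 * eps) * norm1 x.
Proof.
have e_ge0 := eps_ge0 F; set c := 2 ^+ n.+1 => small.
have c_ge2 : 2 <= c by rewrite /c exprS ler_peMr // exprn_ege1 ?ler1n.
have e_le : eps <= 4^-1 by nra.
have e_le1 : eps <= 1 by lra.
have S_ge0 := norm1_ge0 x; set S := norm1 x in S_ge0 *.
rewrite /fl_reflect; case: eqP => [->|/eqP v_neq0].
  by rewrite reflection0 subrr normr0 !mulr_ge0 //; lra.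
have N_gt0 : 0 < dotv v v by rewrite dotv_gt0.
rewrite [reflection v x]/reflection !mxE; set N := dotv v v in N_gt0 *.
have [d1 d1_le ->] : exists2 d, `|d| <= c * eps & fl_dotv F v v = N * (1 + d).
  exists ((fl_dotv F v v - N) / N); last by field; rewrite gt_eqF.
  rewrite normf_div (gtr0_norm N_gt0) ler_pdivrMr //.
  apply: le_trans (fl_dotv_err F e_le1 v v) _.
  rewrite ler_wpM2l ?mulr_ge0 // ?exprn_ge0 //.
  by apply: ler_sum => j _; rewrite ger0_norm // -expr2 sqr_ge0.
have /ler_normlP[d1_lo d1_hi] : `|d1| <= 2^-1 by lra.
have d1_neq0 : 1 + d1 != 0 by rewrite gt_eqF //; lra.
have N1_neq0 : N * (1 + d1) != 0 by rewrite mulf_neq0 // gt_eqF.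
have [d2 d2_le ->] := fl_divP F 2 N1_neq0.
have [d3 d3_le ->] := fl_mulP F (2 / (N * (1 + d1)) * (1 + d2)) (fl_dotv F v x).
set a := _ * (1 + d3).
have [d4 d4_le ->] := fl_mulP F a (v i 0).
have [d5 d5_le ->] := fl_subP F (x i 0) (a * v i 0 * (1 + d4)).
(* y is half of the exact correction, z the contribution of the error of the
   computed <v, x>, theta the accumulated relative error of the other operations *)
pose y := dotv v x * v i 0 / N.
pose z := (fl_dotv F v x - dotv v x) * v i 0 / N.
pose theta := (1 + d2) * (1 + d3) * (1 + d4) / (1 + d1).
have y_le : `|y| <= S.
  rewrite /y normf_div normrM (gtr0_norm N_gt0) ler_pdivrMr // mulrC [leRHS]mulrC.
  apply: le_trans (entry_mul_abs_dotv v x i).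
  by rewrite ler_wpM2l // ler_norm_sum.
have z_le : `|z| <= c * eps * S.
  rewrite /z normf_div normrM (gtr0_norm N_gt0) ler_pdivrMr // mulrC.
  have le1 := fl_dotv_err F e_le1 v x.
  apply: le_trans (ler_wpM2l (normr_ge0 _) le1) _.
  rewrite mulrCA -[leRHS]mulrA ler_wpM2l ?mulr_ge0 ?exprn_ge0 // [leRHS]mulrC.
  exact: entry_mul_abs_dotv.
have -> : a * v i 0 * (1 + d4) = 2 * (y + z) * theta.
  rewrite /a /y /z /theta; field.
  by rewrite d1_neq0 gt_eqF.
have -> : 2 * dotv v x / N * v i 0 = 2 * y by rewrite /y; ring.
have theta_le : `|theta - 1| <= 9 * (c * eps).
  have q_le : `|(1 + d2) * (1 + d3) * (1 + d4) - 1| <= 7 * eps.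
    have -> : (1 + d2) * (1 + d3) = 1 + ((1 + d2) * (1 + d3) - 1) by ring.
    have le3 := rel_err_mul d2_le d3_le e_le1.
    by have := rel_err_mul le3 d4_le e_le1; lra.
  have -> : theta - 1 = ((1 + d2) * (1 + d3) * (1 + d4) - 1 - d1) / (1 + d1).
    by rewrite /theta; field.
  rewrite normf_div ler_pdivrMr ?normr_gt0 //.
  have hlf : 2^-1 <= `|1 + d1| by rewrite ger0_norm; lra.
  apply: le_trans (ler_normB _ _) _.
  have : 9 * (c * eps) * 2^-1 <= 9 * (c * eps) * `|1 + d1|.
    by rewrite ler_wpM2l // mulr_ge0 // mulr_ge0 //; lra.
  have : 2 * eps <= c * eps by rewrite ler_wpM2r.
  lra.
have ce_ge0 : 0 <= c * eps by apply: le_trans d1_le.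
have theta_le6 : `|theta| <= 6.
  rewrite -[theta](subrK 1); apply: le_trans (ler_normD _ _) _; rewrite normr1.
  move: theta_le; set T := `|_|; lra.
have -> : (x i 0 - 2 * (y + z) * theta) * (1 + d5) - (x i 0 - 2 * y) =
  - (2 * (y * (theta - 1)) + 2 * (z * theta)) * (1 + d5) + (x i 0 - 2 * y) * d5 by ring.
apply: le_trans (ler_normD _ _) _; rewrite !normrM normrN.
(* the first term is at most 2 (18 + 12) c eps S, where the factor 2 bounds the
   last rounding; the second is at most 3 eps S <= 2 c eps S *)
have h1 : `|y * (theta - 1)| <= S * (9 * (c * eps)) by rewrite normrM ler_pM.
have h2 : `|z * theta| <= c * eps * S * 6 by rewrite normrM ler_pM.
have h3 : `|x i 0 - 2 * y| * `|d5| <= 3 * S * eps.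
  rewrite ler_pM //; apply: le_trans (ler_normB _ _) _; rewrite normrM ger0_norm //.
  by have := entry_norm1 x i; rewrite -/S; lra.
have h4 : `|2 * (y * (theta - 1)) + 2 * (z * theta)| <= 30 * (c * eps * S).
  apply: le_trans (ler_normD _ _) _; rewrite !(normrM 2) ger0_norm //; lra.
have h5 : `|1 + d5| <= 2.
  by apply: le_trans (ler_normD _ _) _; rewrite normr1; lra.
have h6 := ler_pM (normr_ge0 _) (normr_ge0 _) h4 h5.
have h7 : 2 * eps * S <= c * eps * S by rewrite !ler_wpM2r.
have h8 : 0 <= c * eps * S by rewrite mulr_ge0.
lra.
Qed.

(** Errors propagate through the remaining reflections by linearity; each of them
    multiplies the 1-norm by at most 3n. *)
Lemma fl_reflections_err (R : realType) n l : exists2 K : R, 0 <= K &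
  forall (eps : R) (F : fp_arith eps) (s : seq 'cV[R]_n) (x : 'cV[R]_n),
    2 ^+ n.+1 * eps <= 2^-1 -> (size s <= l)%N ->
    norm1 (foldr (@fl_reflect _ _ F n) x s - foldr (@reflection R n) x s)
      <= K * eps * norm1 x.
Proof.
elim: l => [|l [K K_ge0 IHl]].
  by exists 0 => // eps F [|//] x _ _ /=; rewrite subrr norm1_0 !mul0r.
pose c : R := n%:R * (62 * 2 ^+ n.+1).
have c_ge0 : 0 <= c by rewrite mulr_ge0 ?ler0n // mulr_ge0 // exprn_ge0.
have n_ge0 : 0 <= n%:R :> R by rewrite ler0n.
have exact_le (s : seq 'cV[R]_n) x : norm1 (foldr (@reflection R n) x s)
    <= (1 + n%:R * 3) ^+ size s * norm1 x.
  elim: s => [|v s IHs] /=; first by rewrite mul1r.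
  apply: le_trans (norm1_reflection _ _) _; rewrite exprS -[leRHS]mulrA mulrA.
  by apply: ler_pM; rewrite ?mulr_ge0 ?norm1_ge0 // lerDr.
pose L : R := (1 + n%:R * 3) ^+ l.
exists (c * (L + K) + n%:R * 3 * K).
  by rewrite addr_ge0 ?mulr_ge0 ?addr_ge0 ?exprn_ge0 ?addr_ge0 ?mulr_ge0.
move=> eps F s x small; have e_ge0 := eps_ge0 F; case: s => [|v s] /= size_s.
  rewrite subrr norm1_0 !mulr_ge0 ?norm1_ge0 ?addr_ge0 ?mulr_ge0 //.
  by rewrite addr_ge0 ?exprn_ge0 ?addr_ge0 ?mulr_ge0.
have e_le1 : eps <= 1.
  have : 1 * eps <= 2 ^+ n.+1 * eps by rewrite ler_wpM2r // exprn_ege1 ?ler1n.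
  lra.
set y := foldr (@fl_reflect _ _ F n) x s; set z := foldr _ x s.
have yz_le : norm1 (y - z) <= K * eps * norm1 x := IHl eps F s x small size_s.
have z_le : norm1 z <= L * norm1 x.
  apply: le_trans (exact_le s x) _; rewrite ler_wpM2r ?norm1_ge0 //.
  by rewrite ler_weXn2l // lerDl mulr_ge0.
have y_le : norm1 y <= (L + K) * norm1 x.
  rewrite -[y](subrK z); apply: le_trans (norm1D _ _) _.
  have : K * eps * norm1 x <= K * 1 * norm1 x.
    by rewrite ler_wpM2r ?norm1_ge0 // ler_wpM2l.
  lra.
have -> : fl_reflect F v y - reflection v z =
    (fl_reflect F v y - reflection v y) + reflection v (y - z).
  by rewrite reflectionB addrA subrK.
apply: le_trans (norm1D _ _) _.
have -> : (c * (L + K) + n%:R * 3 * K) * eps * norm1 x =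
    c * eps * ((L + K) * norm1 x) + n%:R * (3 * (K * eps * norm1 x)) by ring.
apply: lerD.
  have err : norm1 (fl_reflect F v y - reflection v y) <= c * eps * norm1 y.
    apply: le_trans (norm1_le (c := 62 * (2 ^+ n.+1 * eps) * norm1 y) _) _.
      by move=> i; rewrite [in X in `|X|]mxE [in X in _ + X]mxE; exact: fl_reflect_err.
    by rewrite le_eqVlt; apply/orP; left; apply/eqP; rewrite /c; ring.
  by apply: le_trans err _; rewrite ler_wpM2l // mulr_ge0.
apply: le_trans (norm1_reflection _ _) _.
by rewrite !ler_wpM2l.
Qed.

(** * The Householder Arnoldi process *)

Section HouseholderArnoldi.
Variables (R : realType) (n : nat).

Lemma foldr_reflection_isometry (s : seq 'cV[R]_n) x y :
  dotv (foldr (@reflection R n) x s) (foldr (@reflection R n) y s) = dotv x y.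
Proof. by elim: s => //= v s IHs; rewrite reflection_isometry. Qed.

Lemma foldr_reflection_delta (s : seq 'cV[R]_n) (i : 'I_n) :
  {in s, forall v : 'cV[R]_n, v i 0 = 0} ->
  foldr (@reflection R n) (delta_mx i 0) s = delta_mx i 0.
Proof.
elim: s => //= v s IHs s0; rewrite IHs => [|w ws]; last by rewrite s0 // inE ws orbT.
by rewrite reflection_delta // s0 ?mem_head.
Qed.

Variables (eps : R) (F : fp_arith eps) (C : 'M[R]_n) (b : 'cV[R]_n).
Local Notation vecs := (fl_arnoldi_house_vecs F C b).

Lemma size_house_vecs k : size (vecs k) = k.+1.
Proof. by elim: k => //= k IHk; rewrite size_rcons IHk. Qed.

Lemma take_house_vecs k j : (j <= k)%N -> take j.+1 (vecs k) = vecs j.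
Proof.
elim: k => [|k IHk]; first by rewrite leqn0 => /eqP->.
rewrite leq_eqVlt => /predU1P[->|lt_jk].
  by rewrite take_oversize ?size_house_vecs.
by rewrite /= -cats1 takel_cat ?size_house_vecs // IHk.
Qed.

(** Holds exactly, not up to rounding: the leading entries of a Householder vector
    are set to 0, not computed. Out of range, nth returns the zero vector. *)
Lemma house_vecs_zero k l (i : 'I_n) :
  (i < l)%N -> (vecs k)`_l i 0 = 0.
Proof.
have house0 j z : (i < j)%N -> fl_house F j z i 0 = 0.
  by move=> lt_ij; rewrite !mxE (ltn_eqF lt_ij) lt_ij.
elim: k l => [|k IHk] [|l] //= lt_il.
  by rewrite nth_nil mxE.
rewrite nth_rcons size_house_vecs; case: ifP => _; first exact: IHk.
by case: eqP => [<-|_]; [rewrite house0 | rewrite mxE].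
Qed.

Lemma house_colE k (lt_kn : (k < n)%N) :
  fl_house_col F (vecs k) =
  foldr (@fl_reflect R eps F n) (delta_mx (Ordinal lt_kn) 0) (vecs k).
Proof.
rewrite /fl_house_col size_house_vecs; congr foldr.
by apply/colP => i; rewrite !mxE andbT.
Qed.

(** P_{j+1}, ..., P_k fix e_j, so the j-th column may be taken as the image of e_j
    under all of P_0 ... P_k: the columns are images of distinct unit vectors
    under one and the same isometry. *)
Lemma foldr_reflection_house_vecs j k (lt_jn : (j < n)%N) : (j <= k)%N ->
  foldr (@reflection R n) (delta_mx (Ordinal lt_jn) 0) (vecs j) =
  foldr (@reflection R n) (delta_mx (Ordinal lt_jn) 0) (vecs k).
Proof.
move=> le_jk; rewrite -[in RHS](cat_take_drop j.+1 (vecs k)) foldr_cat.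
rewrite take_house_vecs // [in RHS]foldr_reflection_delta // => v /(nthP 0)[l _ <-].
by rewrite nth_drop house_vecs_zero //= leq_addr.
Qed.

End HouseholderArnoldi.

Lemma kappa2_fl_arnoldi_householder (R : realType) n (C : 'M[R]_n) b k :
  (k < n)%N ->
  exists K : R, \forall eps \near (0 : R)^'+, forall F : fp_arith eps,
    let Q := fl_arnoldi_matrix F Householder C b k in
    0 < sigma_min Q /\ `|kappa2 Q - 1| <= K * eps.
Proof.
move=> lt_kn; have [K K_ge0 err] := fl_reflections_err R n k.+1.
exists (12 * n%:R * k.+1%:R * K).
have := near_mul_le1 (2 * 2 ^+ n.+1 : R).
have := near_mul_le1 (6 * n%:R * k.+1%:R * K); have := near_mul_le1 K.
apply: filterS3 => eps small1 small2 small3 F /=.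
pose vs := fl_arnoldi_house_vecs F C b k.
have lt_n (j : 'I_k.+1) : (j < n)%N by exact: leq_trans (ltn_ord j) lt_kn.
pose P : 'M[R]_(n, k.+1) :=
  \matrix_(i, j) foldr (@reflection R n) (delta_mx (Ordinal (lt_n j)) 0) vs i 0.
have -> : 12 * n%:R * k.+1%:R * K * eps = 12 * n%:R * k.+1%:R * (K * eps).
  by rewrite !mulrA.
apply: (kappa2_near_orthonormal (P := P)); rewrite ?mulrA //.
- apply/matrixP => i j; rewrite [RHS]mxE -[(i == j)](inj_eq val_inj).
  transitivity (dotv (foldr (@reflection R n) (delta_mx (Ordinal (lt_n i)) 0) vs)
    (foldr (@reflection R n) (delta_mx (Ordinal (lt_n j)) 0) vs)).
    by rewrite mxE; apply: eq_bigr => l _; rewrite !mxE.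
  by rewrite foldr_reflection_isometry dotv_delta.
- move=> i j; rewrite !mxE -/vs /fl_arnoldi_house (nth_map 0%N) ?size_iota // nth_iota //=.
  rewrite (house_colE _ _ _ (lt_n j)) /vs -(foldr_reflection_house_vecs _ _ _ (lt_n j) (ltn_ord j)).
  set x := delta_mx _ _; set s := fl_arnoldi_house_vecs F C b j.
  have := err eps F s x; rewrite size_house_vecs norm1_delta mulr1.
  set D := norm1 _; move=> D_le; apply: le_trans (D_le _ _) => //; last by lra.
  by apply: le_trans (entry_norm1 _ i); rewrite !mxE.
Qed.

(** * The Gram-Schmidt Arnoldi process *)

Section FirstOrder.
Variable R : realType.

(** A quantity computed in floating-point arithmetic is a function on this type;
    its behaviour as the machine epsilon tends to 0, uniformly in the
    arithmetic, is its behaviour along the filter [macheps_to_0]. *)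
Definition machine := {eps : R & fp_arith eps}.
Definition macheps (a : machine) : R := projT1 a.
Definition arith (a : machine) : fp_arith (macheps a) := projT2 a.

Definition macheps_to_0 : set_system machine :=
  [set P | \forall eps \near (0 : R)^'+, forall F : fp_arith eps, P (existT _ eps F)].

Lemma ulp_to_0_filter : Filter macheps_to_0.
Proof.
have FF : Filter (0 : R)^'+ by exact: filter_filter.
split=> [|P Q hP hQ|P Q PQ]; first exact: (@filterE _ _ FF).
- by apply: (@filterS2 _ _ FF _ _ _ _ hP hQ) => eps PF QF F; split.
- by apply: (@filterS _ _ FF) => eps PF F; apply: PQ.
Qed.

#[local] Existing Instance ulp_to_0_filter.

Lemma near_macheps (P : set R) :
  (\forall eps \near (0 : R)^'+, P eps) -> \forall a \near macheps_to_0, P (macheps a).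
Proof. by apply: filterS => eps Peps F. Qed.

Lemma macheps_ge0 a : 0 <= macheps a.
Proof. exact: eps_ge0 (arith a). Qed.

(** f = l + O(eps), with the same constant for all arithmetics. *)
Definition approx (f : machine -> R) (l : R) : Prop :=
  exists K, \forall a \near macheps_to_0, `|f a - l| <= K * macheps a.

Implicit Types (f g h : machine -> R) (a : machine) (l c : R).

Lemma approx_ext f g l : f =1 g -> approx f l -> approx g l.
Proof. by move=> /funext->. Qed.

Lemma approx_cst l : approx (fun=> l) l.
Proof. by exists 0; apply: nearW => a; rewrite subrr normr0 mul0r. Qed.

Lemma approx_near f l (d : R) :
  approx f l -> 0 < d -> \forall a \near macheps_to_0, `|f a - l| <= d.
Proof.
move=> [K fl] d_gt0; apply: filterS2 fl (near_macheps (near_mul_le1 (K / d))) => a.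
by move=> le_fl; rewrite mulrAC ler_pdivrMr // mul1r; exact: le_trans.
Qed.

Lemma approx_bounded f l : approx f l -> \forall a \near macheps_to_0, `|f a| <= `|l| + 1.
Proof.
move=> fl; apply: filterS (approx_near fl ltr01) => a le1.
by rewrite -[f a](subrK l) addrC; apply: le_trans (ler_normD _ _) _; rewrite lerD2l.
Qed.

Lemma approx_gt0 f l : approx f l -> 0 < l -> \forall a \near macheps_to_0, l / 2 <= f a.
Proof.
move=> fl l_gt0; apply: filterS (approx_near fl (d := l / 2) _) => [a|]; last by rewrite divr_gt0.
by rewrite ler_distl => /andP[+ _]; lra.
Qed.

(** f is g computed with an error of at most M eps relative to a magnitude h; the
    magnitude need only stay bounded, which its own approximation ensures. *)
Lemma approx_perturb f g h l c (M : R) : approx g l -> approx h c ->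
  (\forall a \near macheps_to_0, `|f a - g a| <= M * macheps a * h a) -> approx f l.
Proof.
move=> [K gl] hc fg; exists (K + `|M| * (`|c| + 1)).
apply: filterS3 gl fg (approx_bounded hc) => a gl fg h_le.
apply: le_trans (ler_distD (g a) _ _) _; rewrite mulrDl addrC lerD //.
apply: le_trans fg _; rewrite mulrAC; apply: ler_wpM2r; first exact: macheps_ge0.
by apply: le_trans (ler_norm _) _; rewrite normrM ler_wpM2l.
Qed.

Lemma approxD f g l c : approx f l -> approx g c -> approx (fun a => f a + g a) (l + c).
Proof.
move=> [K fl] [L gc]; exists (K + L); apply: filterS2 fl gc => a fl gc.
rewrite opprD addrACA mulrDl; apply: le_trans (ler_normD _ _) _.
exact: lerD.
Qed.

Lemma approxM f g l c : approx f l -> approx g c -> approx (fun a => f a * g a) (l * c).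
Proof.
move=> fl gc; have [[K Kfl] [L Lgc]] := (fl, gc).
exists (K * (`|c| + 1) + `|l| * L).
apply: filterS3 Kfl Lgc (approx_bounded gc) => a {}fl {}gc g_le.
have -> : f a * g a - l * c = (f a - l) * g a + l * (g a - c) by ring.
apply: le_trans (ler_normD _ _) _; rewrite [leRHS]mulrDl !normrM; apply: lerD.
  by rewrite mulrAC; apply: ler_pM.
by rewrite -mulrA ler_wpM2l.
Qed.

Lemma approxN f l : approx f l -> approx (fun a => - f a) (- l).
Proof. by move=> [K fl]; exists K; apply: filterS fl => a; rewrite -opprD normrN. Qed.

Lemma approxB f g l c : approx f l -> approx g c -> approx (fun a => f a - g a) (l - c).
Proof. by move=> fl /approxN; exact: approxD. Qed.

Lemma approx_norm f l : approx f l -> approx (fun a => `|f a|) `|l|.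
Proof.
by move=> [K fl]; exists K; apply: filterS fl => a; apply: le_trans (ler_dist_dist _ _).
Qed.

Lemma approx_sum (I : finType) (f : I -> machine -> R) (l : I -> R) :
  (forall i, approx (f i) (l i)) -> approx (fun a => \sum_i f i a) (\sum_i l i).
Proof.
move=> fl; elim: (index_enum I) => [|i r IHr].
  by rewrite big_nil; under [X in approx X]funext do rewrite big_nil; exact: approx_cst.
rewrite big_cons; under [X in approx X]funext do rewrite big_cons.
exact: approxD.
Qed.

Lemma approxV f l : 0 < l -> approx f l -> approx (fun a => (f a)^-1) l^-1.
Proof.
move=> l_gt0 fl; have [K Kfl] := fl; exists (K * (2 / l ^+ 2)).
apply: filterS2 Kfl (approx_gt0 fl l_gt0) => a {}fl f_ge.
have f_gt0 : 0 < f a by apply: lt_le_trans f_ge; rewrite divr_gt0.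
have -> : (f a)^-1 - l^-1 = - (f a - l) / (f a * l) by field; rewrite !gt_eqF.
rewrite normf_div normrN (gtr0_norm (mulr_gt0 _ _)) // ler_pdivrMr ?mulr_gt0 //.
have Ku_ge0 : 0 <= K * macheps a by apply: le_trans fl.
apply: le_trans fl _.
have -> : K * (2 / l ^+ 2) * macheps a * (f a * l) = K * macheps a * (f a / (l / 2)).
  by field; rewrite gt_eqF.
by rewrite ler_peMr // ler_pdivlMr ?mul1r // divr_gt0.
Qed.

Lemma approx_sqrt f l : 0 < l -> approx f l -> approx (fun a => Num.sqrt (f a)) (Num.sqrt l).
Proof.
move=> l_gt0 fl; have [K Kfl] := fl; exists (K / Num.sqrt l).
apply: filterS2 Kfl (approx_gt0 fl l_gt0) => a {}fl f_ge.
have f_gt0 : 0 < f a by apply: lt_le_trans f_ge; rewrite divr_gt0.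
have s_gt0 : 0 < Num.sqrt l by rewrite sqrtr_gt0.
have t_ge0 := sqrtr_ge0 (f a).
rewrite mulrAC ler_pdivlMr //; apply: le_trans fl.
rewrite -[in leRHS](sqr_sqrtr (ltW f_gt0)) -[in leRHS](sqr_sqrtr (ltW l_gt0)).
by rewrite subr_sqr normrM ler_wpM2l // ger0_norm ?lerDr ?addr_ge0 // ltW.
Qed.

Section Kernels.
Variable n : nat.
Implicit Types (U V W : machine -> 'cV[R]_n) (u v w : 'cV[R]_n).
Implicit Types (S : machine -> seq 'cV[R]_n) (s : seq 'cV[R]_n).

Definition approxv V v := forall i, approx (fun a => V a i 0) (v i 0).

Lemma approx_round f g l : approx g l ->
  (\forall a \near macheps_to_0, exists2 d, `|d| <= macheps a & f a = g a * (1 + d)) ->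
  approx f l.
Proof.
move=> gl fg; apply: (@approx_perturb f g (fun a => `|g a|) l `|l| 1) => //.
  exact: approx_norm.
apply: filterS fg => a [d d_le ->].
by rewrite mulrDr mulr1 addrAC subrr add0r normrM mulrC mul1r ler_wpM2r.
Qed.

Lemma approx_fl_dotv U V u v : approxv U u -> approxv V v ->
  approx (fun a => fl_dotv (arith a) (U a) (V a)) (dotv u v).
Proof.
move=> Uu Vv.
have prod i : approx (fun a => U a i 0 * V a i 0) (u i 0 * v i 0).
  exact: approxM.
apply: (@approx_perturb _ (fun a => dotv (U a) (V a))
  (fun a => \sum_i `|U a i 0 * V a i 0|) _ (\sum_i `|u i 0 * v i 0|) (2 ^+ n.+1)).
- by apply: approx_sum.
- by apply: approx_sum => i; apply: approx_norm.
apply: filterS (near_macheps (near_mul_le1 1)) => a; rewrite mul1r => eps_le1.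
exact: fl_dotv_err.
Qed.

Lemma approx_fl_normalize V v : v != 0 -> approxv V v ->
  approxv (fun a => fl_normalize (arith a) (V a)) (normalize v).
Proof.
move=> v_neq0 Vv i; have dot_gt0 : 0 < dotv v v by rewrite dotv_gt0.
have dotVv := approx_fl_dotv Vv Vv.
have normV : approx (fun a => fl_norm2 (arith a) (V a)) (norm2 v).
  apply: approx_round (approx_sqrt dot_gt0 dotVv) _.
  apply: filterS (approx_gt0 dotVv dot_gt0) => a le_dot.
  by apply: fl_sqrtP; apply: le_trans le_dot; rewrite divr_ge0 // ltW.
have norm_gt0 : 0 < norm2 v by rewrite sqrtr_gt0.
rewrite mxE mulrC; under [X in approx X]funext do rewrite mxE.
apply: approx_round (approxM (Vv i) (approxV norm_gt0 normV)) _.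
apply: filterS (approx_gt0 normV norm_gt0) => a le_norm; apply: fl_divP.
by rewrite gt_eqF // (lt_le_trans _ le_norm) // divr_gt0.
Qed.

Lemma approx_fl_mulmx (C : 'M[R]_n) V v : approxv V v ->
  approxv (fun a => fl_mulmx (arith a) C (V a)) (C *m v).
Proof.
move=> Vv i; have -> : (C *m v) i 0 = dotv (row i C)^T v.
  by rewrite dotvE trmxK -row_mul [RHS]mxE.
have rowC : approxv (fun=> (row i C)^T) (row i C)^T by move=> j; exact: approx_cst.
apply: approx_ext (approx_fl_dotv rowC Vv) => a.
by rewrite mxE; congr fl_sum; apply: eq_map => j; rewrite !mxE.
Qed.

Lemma approx_fl_submul W w f l V v : approxv W w -> approx f l -> approxv V v ->
  approxv (fun a => fl_submul (arith a) (W a) (f a) (V a)) (w - l *: v).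
Proof.
move=> Ww fl Vv i; rewrite !mxE; under [X in approx X]funext do rewrite mxE.
have prod : approx (fun a => fl_mul (arith a) (f a) (V a i 0)) (l * v i 0).
  by apply: approx_round (approxM fl (Vv i)) _; apply: nearW => a; apply: fl_mulP.
by apply: approx_round (approxB (Ww i) prod) _; apply: nearW => a; apply: fl_subP.
Qed.

Definition approxs S s :=
  (forall a, size (S a) = size s) /\ forall i, approxv (fun a => (S a)`_i) s`_i.

Lemma approxs_rcons S s V v : approxs S s -> approxv V v ->
  approxs (fun a => rcons (S a) (V a)) (rcons s v).
Proof.
move=> [size_S Ss] Vv; split=> [a|i]; first by rewrite !size_rcons size_S.
rewrite nth_rcons; under [X in approxv X]funext do rewrite nth_rcons size_S.
by case: ifP => _; [exact: Ss | case: ifP => // _ j; exact: approx_cst].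
Qed.

Lemma approx_fl_mgs_pass S s W w : orthonormal s -> approxs S s -> approxv W w ->
  approxv (fun a => fl_mgs_pass (arith a) (S a) (W a)) (project_out s w).
Proof.
move=> orth_s; rewrite -(mgs_pass_exact w orth_s) => {orth_s}.
elim: s S W w => [|q s IHs] S W w [size_S Ss] Ww.
  by under [X in approxv X]funext do rewrite (size0nil (size_S _)).
have SE a : S a = (S a)`_0 :: behead (S a).
  by case: (S a) (size_S a).
under [X in approxv X]funext do rewrite SE.
apply: (IHs (fun a => behead (S a))
  (fun a => fl_submul (arith a) (W a) (fl_dotv (arith a) (S a)`_0 (W a)) (S a)`_0)).
- split=> [a|i]; first by rewrite size_behead size_S.
  by under [X in approxv X]funext do rewrite nth_behead; exact: (Ss i.+1).
- by apply: approx_fl_submul (Ss 0%N) => //; apply: approx_fl_dotv (Ss 0%N) Ww.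
Qed.

End Kernels.

(** Absence of breakdown in the exact process keeps the norms by which the
    floating-point process divides away from 0, so that normalization is
    Lipschitz there. *)
Lemma approx_fl_arnoldi_mgs2 n (C : 'M[R]_n) b k : b != 0 ->
  arnoldi_no_breakdown C b k ->
  approxs (fun a => fl_arnoldi_mgs2 (arith a) C b k) (arnoldi C b k).
Proof.
move=> b_neq0; elim: k => [|k IHk] no_bd /=.
  split=> // -[|i] /=; last by rewrite nth_nil => j; exact: approx_cst.
  by apply: approx_fl_normalize => // i; exact: approx_cst.
have no_bd_k : arnoldi_no_breakdown C b k by move=> j lt_jk; apply: no_bd; exact: ltnW.
have {IHk}[size_S Ss] := IHk no_bd_k.
have orth := arnoldi_orthonormal b_neq0 no_bd_k.
apply: approxs_rcons => //; apply: approx_fl_normalize; first exact: no_bd.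
rewrite arnoldi_remainder_project.
have last_approx : approxv (fun a => last 0 (fl_arnoldi_mgs2 (arith a) C b k))
    (last 0 (arnoldi C b k)).
  rewrite -nth_last; under [X in approxv X]funext do rewrite -nth_last size_S.
  exact: Ss.
(* one exact projection per floating-point pass *)
rewrite -(project_out_idem _ orth); apply: approx_fl_mgs_pass => //.
by apply: approx_fl_mgs_pass => //; exact: approx_fl_mulmx.
Qed.

Lemma kappa2_fl_arnoldi_mgs2 n (C : 'M[R]_n) b k : b != 0 ->
  arnoldi_no_breakdown C b k ->
  exists K : R, \forall eps \near (0 : R)^'+, forall F : fp_arith eps,
    let Q := fl_arnoldi_matrix F MGS2 C b k in
    0 < sigma_min Q /\ `|kappa2 Q - 1| <= K * eps.
Proof.
move=> b_neq0 no_bd; have [_ Ss] := approx_fl_arnoldi_mgs2 b_neq0 no_bd.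
pose Q a := fl_arnoldi_matrix (arith a) MGS2 C b k; pose P := arnoldi_matrix C b k.
(* one constant for all entries: their errors are added up *)
have [K err] : approx (fun a => \sum_i \sum_j `|Q a i j - P i j|) 0.
  have sum0 : \sum_(i < n) \sum_(j < k.+1) `|P i j - P i j| = 0.
    by rewrite big1 // => i _; rewrite big1 // => j _; rewrite subrr normr0.
  rewrite -[X in approx _ X]sum0.
  apply: approx_sum => i; apply: approx_sum => j; apply: approx_norm.
  apply: approxB; last exact: approx_cst.
  by rewrite mxE; under [X in approx X]funext do rewrite mxE; exact: Ss.
exists (12 * n%:R * k.+1%:R * K).
have small1 := near_macheps (near_mul_le1 K).
have small2 := near_macheps (near_mul_le1 (6 * n%:R * k.+1%:R * K)).
suff : \forall a \near macheps_to_0,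
    0 < sigma_min (Q a) /\ `|kappa2 (Q a) - 1| <= 12 * n%:R * k.+1%:R * K * macheps a.
  by [].
apply: filterS3 err small1 small2 => a err small1 small2.
have -> : 12 * n%:R * k.+1%:R * K * macheps a = 12 * n%:R * k.+1%:R * (K * macheps a).
  by rewrite !mulrA.
apply: (kappa2_near_orthonormal (P := P)); rewrite ?mulrA //.
  by apply: orthonormal_matrix (arnoldi_orthonormal _ _) (size_arnoldi _ _ _).
move=> i j; apply: le_trans err; rewrite subr0 [leRHS]ger0_norm; last first.
  by apply: sumr_ge0 => i' _; apply: sumr_ge0.
rewrite (bigD1 i) //= (bigD1 j) //= -addrA lerDl addr_ge0 ?sumr_ge0 // => i' _.
exact: sumr_ge0.
Qed.

End FirstOrder.

Theorem theorem2 (R : realType) (m k : nat) (t : 'I_m -> R)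
    (t_distinct : injective t) (k_ge1 : (1 <= k)%N)
    (k_le : (k <= 2 * m - 1)%N) :
  let C := confluent_operator t in
  let b := start_vector R m in
  (arnoldi_no_breakdown C b k /\
   hermite_basis_matrix t (arnoldi_matrix C b k)) /\
  (forall alg : reorthogonalization,
    exists K : R, \forall eps \near (0 : R)^'+,
      forall F : fp_arith eps,
        let Q := fl_arnoldi_matrix F alg C b k in
        0 < sigma_min Q /\ `|kappa2 Q - 1| <= K * eps).
Proof.
move=> C b.
have lt_k : (k < m + m)%N by lia.
have no_bd : arnoldi_no_breakdown C b k by exact: arnoldi_no_breakdown_confluent.
split; first by split=> //; exact: hermite_basis_arnoldi.
case; last exact: kappa2_fl_arnoldi_householder.
by apply: kappa2_fl_arnoldi_mgs2 => //; apply: start_vector_neq0; lia.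
Qed.
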